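(* Let $\mathcal G=\langle\mathcal V,\mathcal E,\mathcal B\rangle$ be a network, where link $E_{uv}\in\mathcal E$ has available bandwidth $B_{uv}\ge 0$. Let $F_1,\dots,F_N$ ($N\ge 1$) be flows with data volumes $V_1,\dots,V_N>0$, and let flow $F_i$ have a pre-determined route $p_i$ in $\mathcal G$ whose nonempty set of links is $\mathcal E_i\subseteq\mathcal E$. Put $X^i_{uv}=1$ if $E_{uv}\in\mathcal E_i$ and $X^i_{uv}=0$ otherwise. For each $i$ and each $E_{uv}\in\mathcal E_i$ define $$b^i_{uv}=\frac{V_i}{\sum_{k=1}^N X^k_{uv}V_k}\,B_{uv},$$ and let $\vec{b^*}=(b^*_1,\dots,b^*_N)$ with $$b^*_i=\min_{E_{uv}\in\mathcal E_i} b^i_{uv},\qquad i=1,\dots,N.$$ Then $\vec{b^*}$ is an optimal solution of the optimization problem OptBA: $$\text{minimize}\quad \max_{i=1,\dots,N}\frac{V_i}{b_i}$$ over $(b_1,\dots,b_N)\in\mathbb R^N$ subject to $$\sum_{i=1}^N X^i_{uv}\,b_i\le B_{uv}\ \text{ for every } E_{uv}\in\mathcal E,\qquad b_i\ge 0\ \text{ for } i=1,\dots,N.$$ That is, $\vec{b^*}$ is feasible, and no feasible $(b_1,\dots,b_N)$ has a strictly smaller objective value.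
   Context: The network is a finite undirected graph with node set $\mathcal V$ and link set $\mathcal E$. Each link between nodes $u$ and $v$ is represented exactly once (as either $E_{uv}$ or $E_{vu}$), and $\mathcal B=\{B_{uv}\}$ records the available bandwidth of the links. A flow $F_i$ has a source node, a destination node and a data volume $V_i$ (the total amount of data to be transferred), and its route $p_i$ is a path from source to destination. The number $b_i$ is the bandwidth allocated to $F_i$ along its route, and $ct_i=V_i/b_i$ is the completion time of $F_i$, with the convention $V_i/0=+\infty$. The objective $\max_i ct_i$ is the coflow completion time. *)

(* Defs.v *)
From HB Require Import structures.
From mathcomp Require Import all_boot all_order all_algebra.
From mathcomp Require Import reals constructive_ereal.

Set Implicit Arguments.
Unset Strict Implicit.
Unset Printing Implicit Defensive.

Import Order.TTheory GRing.Theory Num.Theory.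

Local Open Scope ring_scope.

(* An undirected link between u and v is stored as one ordered pair, either
   (u, v) or (v, u), never both.  The values of [bandwidth] outside [links]
   are irrelevant. *)
Record network (R : realType) := Network {
  node : finType;
  links : {set node * node};
  links_once : forall u v, (u, v) \in links -> (v, u) \in links -> u = v;
  bandwidth : node * node -> R
}.

Definition adjacent (R : realType) (G : network R) : rel (node G) :=
  [rel u v | ((u, v) \in links G) || ((v, u) \in links G)].

(* [route] lists the nodes visited after [source].  Repeated nodes are
   allowed, so simple paths are a special case. *)
Record flow (R : realType) (G : network R) := Flow {
  source : node G;
  destination : node G;
  volume : R;
  route : seq (node G);
  route_path : path (@adjacent R G) source route;
  route_last : last source route = destination
}.

(* A link counts as traversed whichever way the route crosses it. *)
Definition route_links (R : realType) (G : network R) (f : flow G) :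
    {set node G * node G} :=
  let steps := zip (source f :: route f) (route f) in
  [set e in links G | (e \in steps) || ((e.2, e.1) \in steps)].

Definition incidence (R : realType) (G : network R) (N : nat)
    (F : 'I_N -> flow G) (i : 'I_N) (e : node G * node G) : R :=
  (e \in route_links (F i))%:R.

(* Minimum of a real function over a finite set.  It is taken in the extended
   reals, whose top element is the neutral element of the minimum; the value
   on the empty set is the junk value 0 (see [set_minP]
   for nonempty sets). *)
Definition set_min (R : realType) (T : finType) (A : {set T}) (f : T -> R) : R :=
  fine (\big[mine/+oo%E]_(e in A) (f e)%:E).

Lemma set_minP (R : realType) (T : finType) (A : {set T}) (f : T -> R) :
  A != set0 ->
  (exists2 e, e \in A & set_min A f = f e) /\
  (forall e, e \in A -> set_min A f <= f e).
Proof.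
case/set0Pn => a aA.
have [e eA eP] : exists2 e, e \in A & forall e', e' \in A -> f e <= f e'.
  by case: (arg_minP f aA) => e eA eP; exists e.
suff -> : set_min A f = f e by split=> //; exists e.
rewrite /set_min; suff -> : \big[mine/+oo%E]_(x in A) (f x)%:E = (f e)%:E by [].
apply/eqP; rewrite eq_le; apply/andP; split.
  by rewrite (bigD1 e) //= ge_min lexx.
elim/big_ind: _ => [|x y hx hy|x xA]; first by rewrite leey.
  by rewrite le_min hx hy.
by rewrite lee_fin eP.
Qed.

Definition link_share (R : realType) (G : network R) (N : nat)
    (F : 'I_N -> flow G) (i : 'I_N) (e : node G * node G) : R :=
  volume (F i) / (\sum_(k < N) incidence F k e * volume (F k)) * bandwidth e.

Definition bstar (R : realType) (G : network R) (N : nat)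
    (F : 'I_N -> flow G) (i : 'I_N) : R :=
  set_min (route_links (F i)) (link_share F i).

Definition completion_time (R : realType) (V b : R) : \bar R :=
  if b == 0 then +oo%E else (V / b)%:E.

(* For N >= 1 the neutral element -oo of the maximum plays no role. *)
Definition objective (R : realType) (G : network R) (N : nat)
    (F : 'I_N -> flow G) (b : 'I_N -> R) : \bar R :=
  \big[maxe/-oo%E]_(i < N) completion_time (volume (F i)) (b i).

Definition feasible (R : realType) (G : network R) (N : nat)
    (F : 'I_N -> flow G) (b : 'I_N -> R) : Prop :=
  (forall e, e \in links G -> \sum_(i < N) incidence F i e * b i <= bandwidth e)
  /\ (forall i, 0 <= b i).

Definition optimal_OptBA (R : realType) (G : network R) (N : nat)
    (F : 'I_N -> flow G) (b : 'I_N -> R) : Prop :=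
  feasible F b /\
  forall b' : 'I_N -> R, feasible F b' -> ~ (objective F b' < objective F b)%E.

(* Main.v *)
(* Write S_e for the total volume of the flows crossing link e.  Every flow
   crossing e gets at most the fraction V_i / S_e of B_e, and these fractions
   add up to 1, so bstar is feasible.  If a feasible b completes all flows
   within time t, then V_k <= t b_k for all k; summing over the flows crossing
   e gives S_e <= t B_e.  At a bottleneck link e of flow i, the completion time
   of flow i under bstar is exactly S_e / B_e <= t. *)
Require Import Defs.
From mathcomp Require Import all_boot all_order all_algebra.
From mathcomp Require Import reals constructive_ereal.

Import Order.TTheory GRing.Theory Num.Theory.

Local Open Scope ring_scope.

Section OptBA.
Set Implicit Arguments.
Unset Strict Implicit.
Context {R : realType} {G : network R} {N : nat} (F : 'I_N -> flow G).
Implicit Types (i k : 'I_N) (e : node G * node G).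

(** This is $S_e$ of the idea above, the denominator in [link_share]. *)
Definition link_load e : R := \sum_(k < N) incidence F k e * volume (F k).

Hypothesis bandwidth_ge0 : forall e, e \in links G -> 0 <= bandwidth e.
Hypothesis volume_gt0 : forall i, 0 < volume (F i).
Hypothesis links_neq0 : forall i, route_links (F i) != set0.

Lemma incidence_ge0 i e : 0 <= incidence F i e.
Proof. exact: ler0n. Qed.

Lemma route_links_sub i e : e \in route_links (F i) -> e \in links G.
Proof. by rewrite inE => /andP[]. Qed.

Lemma link_load_ge0 e : 0 <= link_load e.
Proof.
by apply: sumr_ge0 => k _; rewrite mulr_ge0 ?incidence_ge0 // ltW.
Qed.

Lemma link_load_gt0 i e : e \in route_links (F i) -> 0 < link_load e.
Proof.
move=> ei; rewrite /link_load (bigD1 i) //= ltr_pwDl //.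
  by rewrite /incidence ei mul1r.
by apply: sumr_ge0 => k _; rewrite mulr_ge0 ?incidence_ge0 // ltW.
Qed.

Lemma bstarP i :
  (exists2 e, e \in route_links (F i) & bstar F i = link_share F i e) /\
  (forall e, e \in route_links (F i) -> bstar F i <= link_share F i e).
Proof. exact: set_minP. Qed.

Lemma bstar_ge0 i : 0 <= bstar F i.
Proof.
have [[e ei ->] _] := bstarP i.
apply: mulr_ge0; last exact: bandwidth_ge0 (route_links_sub ei).
by rewrite divr_ge0 ?link_load_ge0 // ltW.
Qed.

Lemma bstar_feasible : feasible F (bstar F).
Proof.
split; last exact: bstar_ge0.
move=> e eG.
apply: (@le_trans _ _ (\sum_(i < N) incidence F i e * link_share F i e)).
  apply: ler_sum => i _; rewrite /incidence.
  case: (boolP (e \in route_links (F i))) => ei; last by rewrite !mul0r.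
  by rewrite !mul1r (bstarP i).2.
(* The factor $B_e / S_e$ does not depend on [i]; once it is pulled out, the remaining sum is $S_e$
   itself. *)
rewrite (eq_bigr (fun i => incidence F i e * volume (F i)
                           * ((link_load e)^-1 * bandwidth e))); last first.
  by move=> i _; rewrite /link_share -/(link_load e) !mulrA.
rewrite -mulr_suml -/(link_load e) mulrA.
(* On an unused link the load is 0, and so is its quotient by itself. *)
have [->|load_neq0] := eqVneq (link_load e) 0.
  by rewrite !mul0r bandwidth_ge0.
by rewrite divff // mul1r.
Qed.

Lemma link_load_le (b : 'I_N -> R) (t : R) e :
  feasible F b -> 0 <= t -> (forall k, volume (F k) <= t * b k) ->
  e \in links G -> link_load e <= t * bandwidth e.
Proof.
move=> [cap _] t_ge0 vol_le eG.
apply: le_trans (ler_wpM2l t_ge0 (cap e eG)).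
rewrite mulr_sumr; apply: ler_sum => k _.
by rewrite mulrCA ler_wpM2l ?incidence_ge0.
Qed.

Lemma completion_time_bstar_le (t : R) i :
  (forall e, e \in links G -> link_load e <= t * bandwidth e) ->
  (completion_time (volume (F i)) (bstar F i) <= t%:E)%E.
Proof.
move=> load_le.
have [[e ei ->] _] := bstarP i.
have eG := route_links_sub ei; have S_gt0 := link_load_gt0 ei.
(* With zero bandwidth, [load_le] would give $S_e \le 0$, yet flow [i] itself loads [e]. Hence the
   share at [e] is nonzero and the [+oo] branch of [completion_time] is excluded. *)
have B_gt0 : 0 < bandwidth e.
  rewrite lt_neqAle bandwidth_ge0 // andbT; apply/eqP => B0.
  by have := load_le e eG; rewrite -B0 mulr0 leNgt S_gt0.
have V_neq0 := lt0r_neq0 (volume_gt0 i).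
rewrite /completion_time /link_share -/(link_load e).
rewrite !mulf_eq0 invr_eq0 (negPf V_neq0) (gt_eqF S_gt0) (gt_eqF B_gt0) /=.
by rewrite lee_fin !invfM invrK !mulrA divff // mul1r ler_pdivrMr // load_le.
Qed.

(** A finite bound rules out [b = 0], where the completion time is [+oo], so the division can be
    cleared. *)
Lemma completion_time_leP (V b t : R) : 0 < V -> 0 <= b ->
  (completion_time V b <= t%:E)%E -> 0 < t /\ V <= t * b.
Proof.
move=> V_gt0; rewrite /completion_time le_eqVlt eq_sym.
have [-> //|b_neq0 /= b_gt0] := eqVneq b 0.
rewrite lee_fin => le_t; split; first exact: lt_le_trans (divr_gt0 _ _) le_t.
by rewrite -ler_pdivrMr.
Qed.

Lemma bstar_objective_le (b : 'I_N -> R) :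
  feasible F b -> (objective F (bstar F) <= objective F b)%E.
Proof.
move=> b_feas; apply: bigmax_le => [|i _]; first exact: leNye.
have ct_le k : (completion_time (volume (F k)) (b k) <= objective F b)%E.
  exact: le_bigmax.
(* The value [-oo] is impossible, because the completion time of flow [i] is real or [+oo]; the
   value [+oo] bounds everything. Only a real [t] needs the load argument. *)
case: (objective F b) ct_le => [t||] ct_le; first last.
- by have := ct_le i; rewrite /completion_time; case: ifP.
- exact: leey.
have ctP k := completion_time_leP (volume_gt0 k) (b_feas.2 k) (ct_le k).
apply: completion_time_bstar_le => e; apply: link_load_le b_feas _ _.
  (* The sign of [t] comes from flow [i], whose positive volume cannot be sent in time $t \le 0$. *)
  exact: ltW (ctP i).1.
by move=> k; have [] := ctP k.
Qed.

End OptBA.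

Theorem theorem1 (R : realType) (G : network R) (N : nat) (F : 'I_N -> flow G)
    (N_ge1 : (1 <= N)%N)
    (bandwidth_ge0 : forall e, e \in links G -> 0 <= bandwidth e)
    (volume_gt0 : forall i, 0 < volume (F i))
    (links_neq0 : forall i, route_links (F i) != set0) :
  optimal_OptBA F (bstar F).
Proof.
split; first exact: bstar_feasible.
by move=> b b_feas; apply/negP; rewrite -leNgt bstar_objective_le.
Qed.
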